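(* If $T\neq P_4$ is a tree of order $n>2$, then $PRC(T)\leq n-2$, with equality if and only if $T\in\{P_5,P_6,P_7,\mathcal{R}\}$, where $\mathcal{R}$ is the tree with vertex set $\{v_1,\dots,v_6\}$ and edge set $\{v_1v_2,\,v_1v_3,\,v_1v_4,\,v_3v_5,\,v_4v_6\}$.
   Context: All graphs are simple, finite and undirected; $P_n$ is the path on $n$ vertices. A set $S\subseteq V(G)$ is a dominating set if every vertex not in $S$ has a neighbor in $S$; $S$ is a perfect dominating set if every vertex in $V(G)\setminus S$ has exactly one neighbor in $S$. A perfect coalition in $G$ consists of two disjoint sets $V_1,V_2$ of vertices such that (i) neither $V_1$ nor $V_2$ is a dominating set of $G$; (ii) each vertex in $V(G)\setminus V_1$ has at most one neighbor in $V_1$, and each vertex in $V(G)\setminus V_2$ has at most one neighbor in $V_2$; (iii) $V_1\cup V_2$ is a perfect dominating set of $G$. A perfect coalition partition ($prc$-partition) of $G$ is a vertex partition $\pi=\{V_1,\dots,V_k\}$ such that each $V_i$ either is a singleton dominating set or forms a perfect coalition with some $V_j\in\pi$. $PRC(G)$ is the maximum cardinality of a $prc$-partition of $G$, with $PRC(G)=0$ if $G$ has no $prc$-partition. *)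

(* Defs.v *)
From mathcomp Require Import all_boot.

Set Implicit Arguments.
Unset Strict Implicit.
Unset Printing Implicit Defensive.

Record sgraph := SGraph {
  vertex :> finType;
  adj : rel vertex;
  adj_sym : symmetric adj;
  adj_irrefl : irreflexive adj }.

Definition isomorphic (G H : sgraph) : Prop :=
  exists2 f : G -> H, bijective f & forall x y, adj (f x) (f y) = adj x y.

Definition connected_graph (G : sgraph) : Prop :=
  forall x y : G, connect (@adj G) x y.

(* [ucycle] also accepts the empty sequence and [:: x; y] for an edge xy;
   the genuine cycles of a simple graph are those of length at least 3. *)
Definition acyclic_graph (G : sgraph) : Prop :=
  forall c : seq G, 2 < size c -> ~ ucycle (@adj G) c.

Definition is_tree (G : sgraph) : Prop :=
  [/\ 0 < #|G|, connected_graph G & acyclic_graph G].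

Section Coalitions.
Variable G : sgraph.
Implicit Types (A B S : {set G}) (P : {set {set G}}) (x : G).

Definition nb_neighbors_in x S : nat := #|[set y in S | adj x y]|.

Definition dominating S : bool :=
  [forall (x | x \notin S), exists y in S, adj x y].

Definition perfect_dominating S : bool :=
  [forall (x | x \notin S), nb_neighbors_in x S == 1].

Definition at_most_one_neighbor S : bool :=
  [forall (x | x \notin S), nb_neighbors_in x S <= 1].

Definition perfect_coalition A B : bool :=
  [&& [disjoint A & B],
      ~~ dominating A && ~~ dominating B,
      at_most_one_neighbor A && at_most_one_neighbor B
    & perfect_dominating (A :|: B)].

Definition prc_partition P : bool :=
  partition P [set: G] &&
  [forall A in P, ((#|A| == 1) && dominating A)
                  || [exists B in P, perfect_coalition A B]].

(* The maximum over an empty family is 0. *)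
Definition PRC : nat := \max_(P : {set {set G}} | prc_partition P) #|P|.

End Coalitions.

Definition path_rel n : rel 'I_n :=
  fun i j => (i.+1 == j :> nat) || (j.+1 == i :> nat).

Lemma path_rel_sym n : symmetric (@path_rel n).
Proof. by move=> i j; rewrite /path_rel orbC. Qed.

Lemma path_rel_irrefl n : irreflexive (@path_rel n).
Proof. by move=> i; rewrite /path_rel orbb eqn_leq ltnn. Qed.

Definition path_graph n : sgraph :=
  SGraph (@path_rel_sym n) (@path_rel_irrefl n).

(* The vertex v_(i+1) of the tree R is encoded as i : 'I_6. *)
Definition treeR_edges : seq (nat * nat) :=
  [:: (0, 1); (0, 2); (0, 3); (2, 4); (3, 5)].

Definition treeR_rel : rel 'I_6 :=
  fun i j => ((val i, val j) \in treeR_edges) || ((val j, val i) \in treeR_edges).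

Lemma treeR_rel_sym : symmetric treeR_rel.
Proof. by move=> i j; rewrite /treeR_rel orbC. Qed.

Lemma treeR_rel_irrefl : irreflexive treeR_rel.
Proof. by case=> [[|[|[|[|[|[|]]]]]]]. Qed.

Definition treeR : sgraph := SGraph treeR_rel_sym treeR_rel_irrefl.

(* Main.v *)
Require Import Defs.
From mathcomp Require Import all_boot zify.

(**
A partition with at least [n - 2] parts has almost only singletons. If [X] is a
set of vertices of a tree, at most [#|X|] vertices [b] are such that [X] and
[[set b]] form a coalition: each such [b] dominates all that [X] leaves
undominated, and two of them already force a short cycle or an isolated edge
unless a single vertex [w] is undominated, in which case they are neighbours of [w] with pairwise
distinct neighbours in [X]. Now let [l] be a leaf with neighbour [s]: every
coalition meets [[set l; s]], so every part is a partner of the part of [l] or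
of the part of [s], and counting gives [n <= 8]. The trees with at most 8
vertices, numbered breadth first, are then checked by computation.
*)

Set Implicit Arguments.
Unset Strict Implicit.
Unset Printing Implicit Defensive.

(** * Perfect domination and undominated vertices *)

Section PerfectSets.
Variable G : sgraph.
Implicit Types (A B S X : {set G}) (P : {set {set G}}) (x y z b : G).

Lemma adj_neq x y : adj x y -> x != y.
Proof. by apply: contraTneq => ->; rewrite adj_irrefl. Qed.

Lemma perfect_dominatingP S :
  reflect (forall x, x \notin S ->
             exists2 y, y \in S & forall z, z \in S -> adj x z = (z == y))
          (perfect_dominating S).
Proof.
apply: (iffP forall_inP) => [perfS x /perfS/cards1P[y Ny]|perfS x xS].
  have NyE z : z \in S -> adj x z = (z == y).
    by move=> zS; move/setP/(_ z): Ny; rewrite !inE zS.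
  exists y => //; have : y \in [set y] by rewrite inE.
  by rewrite -Ny inE => /andP[].
have [y yS NyE] := perfS x xS; apply/cards1P; exists y; apply/setP => z.
rewrite !inE; have [/NyE-> //|zS] := boolP (z \in S).
by apply/esym/negbTE; apply: contraNneq zS => ->.
Qed.

Lemma perfect_dominates S x :
  perfect_dominating S -> x \notin S -> exists2 y, y \in S & adj x y.
Proof.
by move/perfect_dominatingP=> perfS /perfS[y yS E]; exists y; rewrite ?E.
Qed.

Lemma perfect_unique S x y z : perfect_dominating S -> x \notin S ->
  y \in S -> z \in S -> adj x y -> adj x z -> y = z.
Proof.
move/perfect_dominatingP=> perfS /perfS[u _ E] yS zS.
by rewrite !E // => /eqP-> /eqP->.
Qed.

Lemma perfect_coalitionC A B : perfect_coalition A B = perfect_coalition B A.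
Proof.
rewrite /perfect_coalition disjoint_sym setUC.
by rewrite (andbC (~~ dominating A)) (andbC (at_most_one_neighbor A)).
Qed.

Definition undominated S : {set G} :=
  [set x | (x \notin S) && [forall y in S, ~~ adj x y]].

Lemma undominatedP S x :
  reflect (x \notin S /\ forall y, y \in S -> ~~ adj x y) (x \in undominated S).
Proof. by rewrite inE; apply: (iffP andP) => -[xS /forall_inP]. Qed.

Lemma undominatedPn S x : x \notin S -> x \notin undominated S ->
  exists2 y, y \in S & adj x y.
Proof.
rewrite inE => xS; rewrite xS /= negb_forall => /existsP[y].
by rewrite negb_imply negbK => /andP[]; exists y.
Qed.

Lemma dominatingE S : dominating S = (undominated S == set0).
Proof.
apply/forall_inP/eqP => [domS|undS x xS].
  apply/setP => x; rewrite [RHS]inE; apply/negP => /undominatedP[xS nadj].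
  by have /exists_inP[y /nadj/negP] := domS x xS.
have : x \notin undominated S by rewrite undS inE.
by move/(undominatedPn xS) => [y yS ad]; apply/exists_inP; exists y.
Qed.

End PerfectSets.

(** * Coalition partners in trees and the bound from a leaf *)

Section Trees.
Variable T : sgraph.
Hypothesis treeT : is_tree T.
Implicit Types (A B S X : {set T}) (P : {set {set T}}) (x y z b : T).

Lemma tree_no_triangle x y z : adj x y -> adj y z -> adj z x -> False.
Proof.
move=> xy yz zx; have [_ _ acT] := treeT; apply: (acT [:: x; y; z]) => //.
by rewrite /ucycle /= xy yz zx !inE !negb_or !adj_neq // adj_sym.
Qed.

Lemma tree_no_square x y z t :
  adj x y -> adj y z -> adj z t -> adj t x -> x != z -> y = t.
Proof.
move=> xy yz zt tx xz; apply/eqP/negP => /negP yt.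
have [_ _ acT] := treeT; apply: (acT [:: x; y; z; t]) => //.
by rewrite /ucycle /= xy yz zt tx !inE !negb_or xz yt !adj_neq // adj_sym.
Qed.

Lemma tree_closed A x :
  x \in A -> (forall y z, y \in A -> adj y z -> z \in A) -> A = setT.
Proof.
move=> xA clA; have [_ conT _] := treeT; apply/setP => y; rewrite inE.
rewrite -xA; apply/esym/(closed_connect _ (conT x y)) => u v uv.
by apply/idP/idP => /clA-> //; rewrite adj_sym.
Qed.

Hypothesis cardT : 2 < #|T|.

Lemma tree_neighbor x : exists y, adj x y.
Proof.
case: (pickP (adj x)) => [y xy|nadj]; first by exists y.
have /(congr1 (fun A : {set T} => #|A|)) : [set x] = setT.
  by apply: (@tree_closed _ x); rewrite ?inE // => y z /set1P->; rewrite nadj.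
by rewrite cards1 cardsT; lia.
Qed.

Lemma tree_not_edge x y :
  (forall z, adj x z -> z = y) -> (forall z, adj y z -> z = x) -> False.
Proof.
move=> Nx Ny; have /(congr1 (fun A : {set T} => #|A|)) : [set x; y] = setT.
  apply: (@tree_closed _ x); rewrite ?set21 // => u v.
  by move=> /set2P[] -> => [/Nx|/Ny] ->; rewrite !inE eqxx ?orbT.
by rewrite cardsT cards2; lia.
Qed.

(* A vertex [t] outside [X] with a neighbour in [X] would have a second one in
   [X :|: [set b]]. *)
Lemma partner_neighbor X b t : perfect_coalition X [set b] ->
  adj b t -> t \notin X -> t \in undominated X.
Proof.
case/and4P; rewrite disjoint_sym disjoints1 => bX _ _ perfS bt tX.
apply/negPn/negP => /(undominatedPn tX)[y yX ty].
have tS : t \notin X :|: [set b].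
  by rewrite !inE negb_or tX eq_sym adj_neq.
have yb : y = b.
  by apply: (perfect_unique perfS tS); rewrite ?inE ?yX ?eqxx ?orbT // adj_sym.
by rewrite -yb yX in bX.
Qed.

Lemma partner_dominates X b w : perfect_coalition X [set b] ->
  w \in undominated X -> w != b -> adj w b.
Proof.
case/and4P=> _ _ _ perfS /undominatedP[wX nadj] wb.
have [|y] := perfect_dominates perfS (x := w); first by rewrite !inE negb_or wX.
by rewrite !inE => /orP[/nadj/negPf-> //|/eqP->].
Qed.

Lemma card_singleton_partners X :
  #|[set b | perfect_coalition X [set b]]| <= #|X|.
Proof.
set B := [set b | _].
have inB b : (b \in B) = perfect_coalition X [set b] by rewrite inE.
have [->|/set0Pn[b0]] := eqVneq B set0; first by rewrite cards0.
rewrite inB => b0P.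
(* In a coalition with the empty set, [[set b0]] would dominate on its own. *)
have X_gt0 : 0 < #|X|.
  rewrite card_gt0; apply/eqP => X0; case/and4P: b0P => _ /andP[_ ndom] _.
  rewrite X0 set0U => perfS; case/negP: ndom; apply/forall_inP => x.
  by move=> /(perfect_dominates perfS)[y yS xy]; apply/exists_inP; exists y.
have /set0Pn[w wW] : undominated X != set0.
  by rewrite -dominatingE; case/and4P: b0P => _ /andP[].
have [W1|/subsetPn[w' w'W]] := boolP (undominated X \subset [set w]).
  have inW x : x \in undominated X -> x = w by move/(subsetP W1)/set1P.
  (* Were [w] a partner, its neighbours would be undominated too, hence equal to [w]. *)
  have wB : w \notin B.
    rewrite inB; apply/negP => wP; have [t wt] := tree_neighbor w.
    have [_ nadj] := undominatedP _ _ wW.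
    have /inW tw : t \in undominated X.
      by apply: (partner_neighbor wP wt _); apply: contraTN wt => /nadj.
    by rewrite tw adj_irrefl in wt.
  have adjB b : b \in B -> adj w b.
    move=> bB; apply: (@partner_dominates X) => //; first by rewrite -inB.
    by apply: contraNneq wB => ->.
  (* The default is not reached on [B]: a partner differs from [w], so it has a neighbour in [X]. *)
  pose f b := odflt b [pick y in X | adj b y].
  have fP b : b \in B -> f b \in X /\ adj b (f b).
    move=> bB; rewrite /f; case: pickP => [y /andP[] //|/= nadj].
    have bX : b \notin X.
      by move: bB; rewrite inB => /and4P[]; rewrite disjoint_sym disjoints1.
    have [||y yX by_] := @undominatedPn _ X b => //; last first.
      by have := nadj y; rewrite yX by_.
    by apply: contraNN wB => /inW <-.
  rewrite -(@card_in_imset _ _ f B).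
    by apply/subset_leq_card/subsetP => _ /imsetP[b /fP[fX _] ->].
  (* Distinct partners with equal values would close a 4-cycle [w], [b], [f b], [b']. *)
  move=> b b' bB b'B ff; have [fX bf] := fP b bB; have [_ b'f] := fP b' b'B.
  apply: (@tree_no_square w b (f b) b'); rewrite ?adjB //.
  - by rewrite adj_sym ff.
  - by rewrite adj_sym adjB.
  - by apply: contraTneq wW => ->; rewrite inE fX.
(* With a second undominated vertex there is at most one partner, which suffices as [X] is
   nonempty. *)
rewrite inE eq_sym => ww'; apply: leq_trans X_gt0.
apply/card_le1P => b bB b' /=; rewrite !inB in bB *.
rewrite [RHS]inE; apply/idP/eqP => [b'P|-> //].
apply/eqP/negPn/negP => bb'.
(* Such a [u] is adjacent to both partners, so these are not adjacent; then another undominated [v]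
   is also adjacent to both and closes a 4-cycle. *)
have sub u : u \in undominated X -> u \notin [set b; b'] -> False.
  move=> uW; rewrite !inE negb_or => /andP[ub ub'].
  have ub_ := partner_dominates bB uW ub.
  have ub'_ := partner_dominates b'P uW ub'.
  have nbb' : ~~ adj b b'.
    apply/negP => abb'; apply: (@tree_no_triangle u b b') => //.
    by rewrite adj_sym.
  have nb v : v \in undominated X -> (v != b) && (v != b').
    move=> vW; apply/andP; split; apply: contra_not_neq (negP nbb') => vE.
      by rewrite -vE; apply: (partner_dominates b'P vW _); rewrite vE eq_sym.
    by rewrite adj_sym -vE; apply: (partner_dominates bB vW _); rewrite vE.
  have [v vW vu] : exists2 v, v \in undominated X & v != u.
    have [wu|] := eqVneq w u; last by exists w.
    by exists w' => //; rewrite -wu eq_sym.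
  have /andP[vb vb'] := nb v vW.
  case/eqP: bb'; apply/esym/(@tree_no_square u b v b') => //.
  - by rewrite adj_sym; apply: (partner_dominates bB vW vb).
  - exact: (partner_dominates b'P vW vb').
  - by rewrite adj_sym.
  - by rewrite eq_sym.
have W_bb' u : u \in undominated X -> (u == b) || (u == b').
  by move=> uW; apply/negPn/negP => ubb'; apply: (sub u uW); rewrite !inE.
have [bW b'W] : b \in undominated X /\ b' \in undominated X.
  by have := W_bb' _ wW; have := W_bb' _ w'W; move=> /orP[]/eqP E' /orP[]/eqP E;
     move: wW w'W ww'; rewrite E E' ?eqxx.
have abb' : adj b b' by apply: (partner_dominates b'P) => //; rewrite eq_sym.
(* Neighbours of an undominated partner are undominated, so [b] and [b'] see only each other. *)
have neighborE u v : perfect_coalition X [set u] -> u \in undominated X ->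
    (forall t, t \in undominated X -> (t == u) || (t == v)) ->
  forall t, adj u t -> t = v.
  move=> uP /undominatedP[_ nadj] WE t ut.
  have /WE : t \in undominated X.
    by apply: (partner_neighbor uP ut _); apply: contraTN ut => /nadj.
  by case/orP => /eqP // tu; rewrite tu adj_irrefl in ut.
apply: (@tree_not_edge b b'); first exact: neighborE.
by apply: neighborE => // t /W_bb'; rewrite orbC.
Qed.

(** A dominating part [[set c]] makes the tree a star. A second such part would give a triangle with
    a third vertex; and if another part [A'] has a partner [B], then [c] has a neighbour in each of
    them, against perfect domination. *)
Lemma prc_partner P A : prc_partition P -> 1 < #|P| -> A \in P ->
  exists2 B, B \in P & perfect_coalition A B.
Proof.
move=> /andP[partP /forall_inP prcP] P_gt1 AP.
have neP B : B \in P -> exists x, x \in B.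
  by move=> BP; apply/set0Pn/(partition_neq0 partP BP).
case/orP: (prcP A AP) => [|/exists_inP//] /andP[/cards1P[c Ac] domA].
have adjc x : x != c -> adj x c.
  move=> xc; move/forall_inP/(_ x): domA; rewrite Ac inE => /(_ xc).
  by case/exists_inP=> y /set1P->.
have [A' A'P A'A] : exists2 A', A' \in P & A' != A.
  case/card_gt1P: P_gt1 => B [B' [BP B'P BB']].
  by have [BA|] := eqVneq B A; [exists B'; rewrite // -BA eq_sym | exists B].
have cA' : c \notin A'.
  apply: contra A'A => cA'; have triv := partition_trivIset partP.
  by rewrite -(def_pblock triv A'P cA') -(def_pblock triv AP (x := c)) ?Ac ?set11.
case/orP: (prcP A' A'P) => [/andP[/cards1P[d A'd] domA']|/exists_inP[B BP]].
  have cd : c != d by rewrite A'd inE in cA'.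
  have adjd x : x != d -> adj x d.
    move=> xd; move/forall_inP/(_ x): domA'; rewrite A'd inE => /(_ xd).
    by case/exists_inP=> y /set1P->.
  have [x] : exists x, x \notin [set c; d].
    apply/existsP; rewrite -negb_forall; apply/forallP => /= all_cd.
    have : #|[set: T]| <= #|[set c; d]|.
      by apply/subset_leq_card/subsetP => x _; apply: all_cd.
    by rewrite cardsT cards2 cd; lia.
  rewrite !inE negb_or => /andP[xc xd]; case: (@tree_no_triangle x c d).
  - exact: adjc.
  - exact: adjd.
  - by rewrite adj_sym adjd.
case/and4P=> disAB /andP[_ ndomB] _ perfS.
have cB : c \notin B.
  apply: contra ndomB => cB; apply/forall_inP => x xB; apply/exists_inP.
  by exists c => //; apply: adjc; apply: contraNneq xB => ->.
have [[y yA'] [z zB]] := (neP _ A'P, neP _ BP).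
have yz : y = z.
  apply: (perfect_unique perfS (x := c));
    rewrite ?inE ?negb_or ?yA' ?zB ?cA' ?orbT //.
    by rewrite adj_sym adjc //; apply: contraNneq cA' => <-.
  by rewrite adj_sym adjc //; apply: contraNneq cB => <-.
by move/pred0P/(_ y): disAB; rewrite /= yA' yz zB.
Qed.

(* The parts of [l] and of [s] together meet every coalition, so each other
   part is a partner of one of them. *)
Lemma leaf_order_bound P (l s : T) : prc_partition P -> 1 < #|P| ->
  #|T| <= #|P| + 2 -> (forall x, adj l x -> x = s) -> #|T| <= 8.
Proof.
move=> prcP P_gt1 leTP leaf; have /andP[partP _] := prcP.
have covP x : x \in cover P by rewrite (cover_partition partP).
pose D := [set pblock P l; pblock P s].
have DP : D \subset P by apply/subsetP => _ /set2P[]->; apply: pblock_mem.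
have partner A : A \in P :\: D -> exists2 X, X \in D & perfect_coalition X A.
  case/setDP=> AP AD; have [B BP coAB] := prc_partner prcP P_gt1 AP.
  exists B; last by rewrite perfect_coalitionC.
  have inD C x : C \in P -> x \in [set l; s] -> x \in C -> C \in D.
    move=> CP xls xC; rewrite -(def_pblock (partition_trivIset partP) CP xC).
    by case/set2P: xls => ->; rewrite !inE eqxx ?orbT.
  have nA x : x \in [set l; s] -> x \notin A.
    by move=> ?; apply: contra AD; apply: inD.
  have [lB|lB] := boolP (l \in B); first by apply: inD BP _ lB; rewrite set21.
  have lA : l \notin A by rewrite nA ?set21.
  have sA : s \notin A by rewrite nA ?set22.
  case/and4P: coAB => _ _ _ perfS; apply: (inD _ s BP); first by rewrite set22.
  (* When [l] lies outside both parts, only [s] can be its neighbour in their union. *)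
  have [|y yS /leaf ys] := perfect_dominates perfS (x := l).
    by rewrite inE negb_or lA.
  by move: yS; rewrite ys inE (negPf sA).
have cardD : #|D| <= 2 by rewrite cards2; case: eqP.
(* The singleton parts outside [D]: each is a partner of a part in [D], so [card_singleton_partners]
   bounds their number. *)
pose Q := [set A in P :\: D | #|A| == 1].
have cardQ : #|Q| <= \sum_(X in D) #|X|.
  pose F (X : {set T}) : {set {set T}} :=
    [set [set b] | b in [set b | perfect_coalition X [set b]]].
  have QF : Q \subset \bigcup_(X in D) F X.
    apply/subsetP => A; rewrite inE => /andP[/partner[X XD coXA] /cards1P[b Ab]].
    by apply/bigcupP; exists X => //; apply/imsetP; exists b; rewrite // inE -Ab.
  apply: leq_trans (subset_leq_card QF) _.
  apply: (big_ind2 (fun (A : {set {set T}}) m => #|A| <= m))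
    => [|A m B k Am Bk|X _].
  - by rewrite cards0.
  - by rewrite cardsU; apply: leq_trans (leq_subr _ _) (leq_add Am Bk).
  - exact: leq_trans (leq_imset_card _ _) (card_singleton_partners X).
have cardPD : 2 * #|P :\: D| <= \sum_(A in P :\: D) #|A| + #|Q|.
  have -> : #|Q| = \sum_(A in P :\: D) (#|A| == 1).
    rewrite -sum1_card (eq_bigl (fun A => (A \in P :\: D) && (#|A| == 1))).
      by rewrite big_mkcondr.
    by move=> A; rewrite inE.
  rewrite mulnC -sum_nat_const -big_split; apply: leq_sum => A /setDP[AP _] /=.
  by have := partition_neq0 partP AP; rewrite -card_gt0; case: #|A| => [|[]].
have cardT_ : #|T| = \sum_(X in D) #|X| + \sum_(A in P :\: D) #|A|.
  rewrite -cardsT (card_partition partP) (big_setID D) /=; congr (_ + _).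
  by apply: eq_bigl => A; rewrite (setIidPr DP).
have cardP : #|P| = #|D| + #|P :\: D|.
  by rewrite -{1}(cardsID D P) (setIidPr DP).
(* With [m = #|P :\: D|], the bounds give [2 * m <= #|T|] and [#|T| <= m + 4]. *)
lia.
Qed.

End Trees.

(** * Enumeration of codes and breadth-first numbering of trees *)

(** Filtering at each length prunes the search: all nonempty prefixes of a generated list satisfy
    [ok], and the entry at position [i] is at most [i]. Both tree codes and colorings are generated
    this way. *)
Fixpoint gen (ok : pred (seq nat)) n : seq (seq nat) :=
  if n is m.+1 then
    [seq s <- [seq rcons s v | s <- gen ok m, v <- iota 0 n] | ok s]
  else [:: [::]].

Lemma gen_rcons ok m s v : s \in gen ok m -> v <= m -> ok (rcons s v) ->
  rcons s v \in gen ok m.+1.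
Proof.
move=> sm vm oks; rewrite mem_filter oks andTb.
by apply/allpairsPdep; exists s, v; split; rewrite // mem_iota.
Qed.

(* In a breadth-first numbering the numbers of the parents are nondecreasing.
   They are shifted by one, so that [0] marks the root. *)
Definition tree_code (q : seq nat) := sorted leq q && all (leq 1) (behead q).

(** One number is the parent of the other. The form with [if] and [eqn] serves evaluation;
    [code_adjE] restores the logical form. *)
Definition code_adj (q : seq nat) : rel nat :=
  fun i j => if eqn (nth 0 q j) i.+1 then true else eqn (nth 0 q i) j.+1.

Lemma code_adjE q i j :
  code_adj q i j = (nth 0 q j == i.+1) || (nth 0 q i == j.+1).
Proof. by []. Qed.

Section Numbering.
Variable T : sgraph.
Hypothesis treeT : is_tree T.

Let inner (s : seq T) : rel T := fun x y => [&& adj x y, x \in s & y \in s].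

(** Invariant of a partial breadth-first search: [s] lists the vertices found, [q] their shifted
    parents. By the last clause, vertices before the latest parent have all their neighbours in [s];
    this keeps the parents nondecreasing. *)
Let numbering (x0 : T) (s : seq T) (q : seq nat) :=
  [/\ [/\ uniq s, x0 \in s & forall x, x \in s -> connect (inner s) x0 x],
      [/\ q \in gen tree_code (size s), size q = size s & tree_code q],
      forall i, i < size s -> nth 0 q i <= i,
      forall i j, i < size s -> j < size s ->
        adj (nth x0 s i) (nth x0 s j) = code_adj q i j
    & forall i y, i.+1 < last 0 q -> adj (nth x0 s i) y -> y \in s].

(** Two distinct neighbours of [y] in [s] are joined by a path inside [s], which [y] would close
    into a cycle. *)
Let inner_unique x0 s x y z : (forall x, x \in s -> connect (inner s) x0 x) ->
  y \notin s -> x \in s -> z \in s -> adj y x -> adj y z -> x = z.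
Proof.
move=> con ys xs zs yx yz; apply/eqP/negPn/negP => xz.
have symi : connect_sym (inner s).
  by apply: sym_connect_sym => u v; rewrite /inner adj_sym (andbC (u \in s)).
have : connect (inner s) x z.
  by apply: connect_trans (con _ zs); rewrite symi con.
case/connectP=> p /shortenP[p' pathp' uniqp' _ lastp'].
have [_ _ acT] := treeT; apply: (acT [:: y, x & p']).
  by case: p' lastp' {pathp' uniqp'} => //= zx; rewrite zx eqxx in xz.
have sub : {subset x :: p' <= s}.
  move=> u; rewrite inE => /predU1P[-> //|up'].
  case/splitPr: up' pathp' => p1 p2; rewrite cat_path /= => /and3P[_].
  by case/and3P.
rewrite /ucycle cons_uniq uniqp' andbT (contra (sub y) ys) andbT /=.
rewrite yx rcons_path -lastp' adj_sym yz andbT /=.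
by apply: sub_path pathp' => u v /andP[].
Qed.

(** The new vertex hangs from the least number with a neighbour outside [s]: connectedness provides
    one, and minimality preserves the last clause of the invariant. *)
Let numbering_step x0 s q : numbering x0 s q -> size s < #|T| ->
  exists y v, numbering x0 (rcons s y) (rcons q v).
Proof.
case=> -[uniqs x0s con] [qgen sizeq codeq] leq_q adjs sat ltsT.
have s_gt0 : 0 < size s by case: s x0s {uniqs con qgen sizeq leq_q adjs sat ltsT}.
pose out i := [exists y, (y \notin s) && adj (nth x0 s i) y].
have exout : exists i, (i < size s) && out i.
  have /hasP[x xs] : has (fun x => [exists y, (y \notin s) && adj x y]) s.
    apply/negPn/negP => /hasPn sat_s.
    have /(congr1 (fun A : {set T} => #|A|)) : [set x in s] = setT.
      apply: (tree_closed treeT (x := x0)); rewrite ?inE // => u v.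
      rewrite !inE => us uv; apply/negPn/negP => vs.
      by move/existsP: (sat_s u us); case; exists v; rewrite vs.
    by rewrite cardsT cardsE (card_uniqP uniqs); lia.
  by move=> outx; exists (index x s); rewrite index_mem xs /out nth_index.
case: (ex_minnP exout) => i /andP[lti /existsP[y /andP[ys siy]]] min_i.
exists y, i.+1; have sis : nth x0 s i \in s by rewrite mem_nth.
have adjy j : j < size s -> adj y (nth x0 s j) = (j == i).
  move=> ltj; apply/idP/eqP => [yj|->]; last by rewrite adj_sym.
  apply/eqP; rewrite -(nth_uniq x0 ltj lti uniqs); apply/eqP.
  by apply: (inner_unique con ys); rewrite ?mem_nth // adj_sym.
(* Vertices before the latest parent have no neighbour outside [s], so [i] is not one of them. *)
have last_i : last 0 q <= i.+1.
  by rewrite leqNgt; apply/negP => /sat/(_ siy); apply/negP.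
have codeq' : tree_code (rcons q i.+1).
  case: q sizeq codeq last_i {qgen leq_q adjs sat} => [|a q] /=.
    by move=> s0; rewrite -s0 in s_gt0.
  rewrite /tree_code /= rcons_path all_rcons /= => _ /andP[-> ->] ->.
  by [].
have sub : subrel (connect (inner s)) (connect (inner (rcons s y))).
  apply: connect_sub => u v /and3P[uv us vs]; apply: connect1.
  by rewrite /inner !mem_rcons !inE uv us vs !orbT.
split.
- split; first by rewrite rcons_uniq ys.
    by rewrite mem_rcons inE x0s orbT.
  move=> x; rewrite mem_rcons inE => /predU1P[->|/con/sub //].
  apply: connect_trans (sub _ _ (con _ sis)) (connect1 _).
  by rewrite /inner siy !mem_rcons !inE sis eqxx orbT.
- by rewrite !size_rcons sizeq; split=> //; apply: gen_rcons.
- move=> j; rewrite size_rcons nth_rcons sizeq ltnS => lej.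
  case: ltnP => [/leq_q//|]; case: eqP => [->|//]; lia.
(* Old vertices have smaller numbers as parents, so the new number is the parent of none. *)
- have H j : j < size s -> code_adj (rcons q i.+1) (size s) j = (j == i).
    move=> ltj; rewrite code_adjE !nth_rcons sizeq ltj ltnn eqxx eqSS.
    by have := leq_q j ltj; case: eqP => [->|_ _]; [lia | rewrite eq_sym].
  have Hs j k : code_adj (rcons q i.+1) j k = code_adj (rcons q i.+1) k j.
    by rewrite !code_adjE orbC.
  move=> j k; rewrite size_rcons !ltnS [j <= _]leq_eqVlt [k <= _]leq_eqVlt.
  case/predU1P=> [->|ltj] /predU1P[->|ltk].
  + rewrite adj_irrefl code_adjE nth_rcons sizeq ltnn eqxx eqSS orbb.
    by apply/esym/negbTE; lia.
  + by rewrite H // !nth_rcons ltnn eqxx ltk adjy.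
  + by rewrite Hs H // !nth_rcons ltnn eqxx ltj adj_sym adjy.
  + by rewrite !nth_rcons ltj ltk adjs // !code_adjE !nth_rcons sizeq ltj ltk.
- move=> j z; rewrite last_rcons ltnS => ltji; have ltj := ltn_trans ltji lti.
  rewrite nth_rcons ltj mem_rcons inE => jz; apply/orP; right.
  apply: contraTT ltji => zs; rewrite -leqNgt; apply: min_i; rewrite ltj.
  by apply/existsP; exists z; rewrite zs.
Qed.

Lemma tree_numbering : exists (x0 : T) s q,
  [/\ uniq s /\ size s = #|T|, q \in gen tree_code #|T|,
      forall i, i < #|T| -> nth 0 q i <= i
    & forall i j, i < #|T| -> j < #|T| ->
        adj (nth x0 s i) (nth x0 s j) = code_adj q i j].
Proof.
have [/card_gt0P[x0 _] _ _] := treeT; exists x0.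
have num m : 0 < m <= #|T| -> exists s q, size s = m /\ numbering x0 s q.
  elim: m => // -[_ _|m IHm /= ltm].
    exists [:: x0], [:: 0]; do ![split=> //] => [|x|[] //|[] // []//].
    - by rewrite inE.
    - by rewrite inE => /eqP->; apply: connect0.
    - by rewrite /= adj_irrefl.
  have [|s [q [sz num]]] := IHm; first exact: ltnW.
  have [|y [v num']] := numbering_step num; first by rewrite sz.
  by exists (rcons s y), (rcons q v); rewrite size_rcons sz.
have [|s [q [sz [[us _ _] [qg _ _] leq_q adjs _]]]] := num #|T|.
  by rewrite leqnn andbT; apply/card_gt0P; exists x0.
by exists s, q; rewrite sz in qg leq_q adjs; split.
Qed.

End Numbering.

(** * Colorings and computable tests *)

(* A coloring gives each vertex the smallest vertex of its part; [coloring]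
   keeps those with at least [size c - 2] classes. *)
Definition class_reps (c : seq nat) :=
  [seq i <- iota 0 (size c) | nth 0 c i == i].

Definition coloring (c : seq nat) :=
  (count (fun i => nth 0 c i != i) (iota 0 (size c)) <= 2) &&
  all (fun i => nth 0 c (nth 0 c i) == nth 0 c i) (iota 0 (size c)).

Definition color_class c a := [seq i <- iota 0 (size c) | nth 0 c i == a].

Definition color_classes c := [seq color_class c a | a <- class_reps c].

(* These tests use [if] and [eqn] where [&&] and [==] would be expected because
   strict evaluation would otherwise explore every branch. *)
Section Checkers.
Variables (n : nat) (H : rel nat).
Implicit Types (S A B : seq nat).

Definition dominatingb S :=
  all (fun v => (v \in S) || has (H v) S) (iota 0 n).

Definition perfectb S :=
  all (fun v => if has (eqn v) S then true else eqn (count (H v) S) 1)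
    (rev (iota 0 n)).

Definition at_most_oneb S :=
  all (fun v => (v \in S) || (count (H v) S <= 1)) (iota 0 n).

Definition coalitionb A B :=
  if perfectb (A ++ B) then
    [&& ~~ has (fun v => v \in B) A, ~~ dominatingb A && ~~ dominatingb B
      & at_most_oneb A && at_most_oneb B]
  else false.

Definition prcb (Q : seq (seq nat)) :=
  all (fun A => if has (coalitionb A) Q then true
                else (size A == 1) && dominatingb A) Q.

(** Backtracking search for an induced copy of [K] in [H]: [t] holds the images of [0, 1, ...]
    chosen so far, and [m] more are wanted. Each candidate is also compared with itself, so that
    loops agree. *)
Fixpoint embedb (K : rel nat) m (t : seq nat) : bool :=
  if m is m'.+1 then
    has (fun v =>
      if (v \notin t) &&
         all (fun i => (K (size t) i == H v (nth 0 (rcons t v) i))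
                    && (K i (size t) == H (nth 0 (rcons t v) i) v))
           (iota 0 (size t).+1)
      then embedb K m' (rcons t v) else false) (iota 0 n)
  else true.

Lemma embedbP K m t : embedb K m t ->
  uniq t -> {subset t <= iota 0 n} ->
  (forall i j, i < size t -> j < size t -> K i j = H (nth 0 t i) (nth 0 t j)) ->
  exists u, [/\ size u = size t + m, uniq u, {subset u <= iota 0 n} &
    forall i j, i < size u -> j < size u -> K i j = H (nth 0 u i) (nth 0 u j)].
Proof.
elim: m t => [|m IHm] t; first by exists t; rewrite addn0; split.
case/hasP=> v vn; case: ifP => // /andP[vt /allP Kv] /IHm IH ut tn Kt.
have KvE i : i <= size t -> K (size t) i = H v (nth 0 (rcons t v) i)
    /\ K i (size t) = H (nth 0 (rcons t v) i) v.
  by move=> lei; have := Kv i; rewrite mem_iota => /(_ lei)/andP[/eqP-> /eqP->].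
have [||i j|u] := IH; first by rewrite rcons_uniq vt.
- by move=> i; rewrite mem_rcons inE => /predU1P[->|/tn].
- rewrite size_rcons !ltnS => lei lej.
  have vE : nth 0 (rcons t v) (size t) = v by rewrite nth_rcons ltnn eqxx.
  have [ltj|] := ltnP j (size t); last first.
    by move=> gej; have -> : j = size t by [lia]; rewrite vE; case: (KvE i).
  have [lti|] := ltnP i (size t); last first.
    by move=> gei; have -> : i = size t by [lia]; rewrite vE; case: (KvE j).
  by rewrite !nth_rcons lti ltj Kt.
by rewrite size_rcons addSnnS; exists u.
Qed.

End Checkers.

(** * From vertex sets to lists of numbers *)

Section Encoding.
Variables (G : sgraph) (x0 : G) (s : seq G) (H : rel nat).
Hypotheses (uniq_s : uniq s) (size_s : size s = #|G|).
Hypothesis adj_s : forall i j, i < #|G| -> j < #|G| ->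
  adj (nth x0 s i) (nth x0 s j) = H i j.
Implicit Types (A B : {set G}) (P : {set {set G}}) (x y : G).

Let n := #|G|.

Let mem_s x : x \in s.
Proof.
have [|| _ ->] := @uniq_min_size _ s (enum G) uniq_s; last by rewrite mem_enum.
  by move=> y; rewrite mem_enum.
by rewrite -cardE size_s.
Qed.

Let index_s x : index x s < n. Proof. by rewrite /n -size_s index_mem. Qed.

Let forall_s (p : pred G) :
  [forall x, p x] = all (fun i => p (nth x0 s i)) (iota 0 n).
Proof.
apply/forallP/allP => [px i _ //|ps x]; rewrite -(nth_index x0 (mem_s x)).
by apply: ps; rewrite mem_iota index_s.
Qed.

Let card_s (p : pred G) : #|p| = count (fun i => p (nth x0 s i)) (iota 0 n).
Proof.
have -> : #|p| = count p s.
  rewrite -size_filter cardE; apply: perm_size; apply: uniq_perm.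
  - exact: enum_uniq.
  - exact: filter_uniq.
  - by move=> x; rewrite mem_enum mem_filter mem_s andbT.
by rewrite -[in LHS](mkseq_nth x0 s) count_map size_s.
Qed.

Definition encode A := [seq i <- iota 0 n | nth x0 s i \in A].

Let mem_encode A i : (i \in encode A) = (i < n) && (nth x0 s i \in A).
Proof. by rewrite mem_filter mem_iota andbC. Qed.

Let size_encode A : size (encode A) = #|A|.
Proof. by rewrite size_filter -card_s. Qed.

Let count_encode A i : i < n ->
  count (H i) (encode A) = nb_neighbors_in (nth x0 s i) A.
Proof.
move=> lti; rewrite /nb_neighbors_in cardsE card_s count_filter.
apply: eq_in_count => j; rewrite mem_iota => /= ltj.
by rewrite -adj_s // andbC.
Qed.

Let has_encode A i : i < n ->
  has (H i) (encode A) = [exists y in A, adj (nth x0 s i) y].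
Proof.
move=> lti; apply/hasP/exists_inP => [[j]|[y yA iy]].
  by rewrite mem_encode => /andP[ltj jA]; rewrite -adj_s //; exists (nth x0 s j).
by exists (index y s); rewrite ?mem_encode -?adj_s ?index_s ?nth_index.
Qed.

Let dominating_encode A : dominating A = dominatingb n H (encode A).
Proof.
rewrite /dominating forall_s; apply: eq_in_all => i; rewrite mem_iota => lti.
by rewrite implyNb mem_encode (lti : i < n) has_encode.
Qed.

Let at_most_one_encode A : at_most_one_neighbor A = at_most_oneb n H (encode A).
Proof.
rewrite /at_most_one_neighbor forall_s; apply: eq_in_all => i.
by rewrite mem_iota => lti; rewrite implyNb mem_encode (lti : i < n) count_encode.
Qed.

(** Stated up to permutation because the union of two disjoint parts is represented by a
    concatenation, which need not be increasing. *)
Let perfect_encode A S : perm_eq (encode A) S ->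
  perfect_dominating A = perfectb n H S.
Proof.
move=> permS; rewrite /perfect_dominating forall_s /perfectb all_rev.
apply: eq_in_all => i; rewrite mem_iota => lti.
rewrite -(permP permS) implyNb count_encode //.
have -> : has (eqn i) S = (i \in encode A).
  by rewrite (perm_mem permS) -has_pred1; apply: eq_has => j; rewrite /= eq_sym.
by rewrite mem_encode (lti : i < n); case: (_ \in _).
Qed.

Let disjoint_encode A B :
  [disjoint A & B] = ~~ has (fun v => v \in encode B) (encode A).
Proof.
rewrite disjoints_subset; apply/subsetP/hasPn => [sAB i|sAB x xA].
  by rewrite !mem_encode => /andP[-> /sAB]; rewrite inE.
rewrite inE; have := sAB (index x s).
by rewrite !mem_encode index_s nth_index // => /(_ xA).
Qed.

Let coalition_encode A B :
  perfect_coalition A B = coalitionb n H (encode A) (encode B).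
Proof.
rewrite /perfect_coalition /coalitionb !dominating_encode !at_most_one_encode.
rewrite -disjoint_encode; have [disAB|_] := boolP [disjoint A & B].
  rewrite (@perfect_encode _ (encode A ++ encode B)).
    by case: ifP; rewrite ?andbF ?andbT.
  apply: uniq_perm; first by rewrite filter_uniq ?iota_uniq.
    by rewrite cat_uniq !filter_uniq ?iota_uniq // has_sym -disjoint_encode disAB.
  by move=> i; rewrite mem_cat !mem_encode inE andb_orr.
by case: ifP.
Qed.

Lemma prcb_encode P (Q : seq (seq nat)) :
  partition P [set: G] ->
  (forall r, reflect (exists2 A, A \in P & r = encode A) (r \in Q)) ->
  prc_partition P = prcb n H Q.
Proof.
move=> partP memQ; rewrite /prc_partition partP /=.
have prcE A :
    ((#|A| == 1) && dominating A) || [exists B in P, perfect_coalition A B] =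
    if has (coalitionb n H (encode A)) Q then true
    else (size (encode A) == 1) && dominatingb n H (encode A).
  have -> : has (coalitionb n H (encode A)) Q =
            [exists B in P, perfect_coalition A B].
    apply/hasP/exists_inP => [[_ /memQ[B BP ->]]|[B BP coAB]].
      by rewrite -coalition_encode; exists B.
    by exists (encode B); rewrite -?coalition_encode //; apply/memQ; exists B.
  by rewrite size_encode -dominating_encode orbC; case: ifP.
apply/forall_inP/allP => [prcP _ /memQ[A AP ->]|prcQ A AP].
  by rewrite -prcE prcP.
by rewrite prcE prcQ //; apply/memQ; exists A.
Qed.

(** Each part contains exactly one fixed point of [c], its representative, so color classes and
    parts correspond. *)
Lemma prcb_coloring P c : partition P [set: G] -> size c = n ->
  (forall i, i < n -> nth 0 c i < n /\ nth 0 c (nth 0 c i) = nth 0 c i) ->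
  (forall i j, i < n -> j < n ->
     (nth 0 c i == nth 0 c j) = (nth x0 s j \in pblock P (nth x0 s i))) ->
  size (class_reps c) = #|P| /\ prc_partition P = prcb n H (color_classes c).
Proof.
move=> partP sizec rootc classc.
have covP x : x \in cover P by rewrite (cover_partition partP).
have triP := partition_trivIset partP.
have mem_reps a : a \in class_reps c = (a < n) && (nth 0 c a == a).
  by rewrite mem_filter mem_iota sizec andbC.
have classE a :
    a \in class_reps c -> color_class c a = encode (pblock P (nth x0 s a)).
  rewrite mem_reps => /andP[lta /eqP ca]; rewrite /color_class sizec.
  apply: eq_in_filter => i; rewrite mem_iota => /= lti.
  by rewrite -{1}ca -classc // eq_sym.
have partE A : A \in P ->
    exists2 a, a \in class_reps c & A = pblock P (nth x0 s a).
  move=> AP; have /set0Pn[x xA] := partition_neq0 partP AP.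
  have [ltc cc] := rootc _ (index_s x).
  exists (nth 0 c (index x s)); first by rewrite mem_reps ltc cc eqxx.
  rewrite -(def_pblock triP AP xA); apply/eqP.
  by rewrite eq_pblock // -[in pblock P x](nth_index x0 (mem_s x)) -classc ?cc.
split.
  rewrite -(size_map (fun a => pblock P (nth x0 s a))) cardE.
  apply: perm_size; apply: uniq_perm; rewrite ?enum_uniq //.
    rewrite map_inj_in_uniq ?filter_uniq ?iota_uniq // => a b.
    rewrite !mem_reps => /andP[lta /eqP ca] /andP[ltb /eqP cb] eqab.
    by apply/eqP; rewrite -ca -cb classc // eqab mem_pblock.
  move=> A; rewrite mem_enum; apply/mapP/idP => [[a _ ->]|/partE//].
  exact: pblock_mem.
apply: prcb_encode => // r.
apply: (iffP mapP) => [[a ra ->]|[A /partE[a ra ->] ->]].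
  by exists (pblock P (nth x0 s a)); rewrite ?pblock_mem ?classE.
by exists a; rewrite ?classE.
Qed.

Lemma prc_coloring P : prc_partition P -> n <= #|P| + 2 ->
  exists2 c, c \in gen coloring n &
    prcb n H (color_classes c) /\ size (class_reps c) = #|P|.
Proof.
move=> prcP leP; have /andP[partP _] := prcP.
have covP x : x \in cover P by rewrite (cover_partition partP).
have triP := partition_trivIset partP.
pose b i := pblock P (nth x0 s i).
pose bs := [seq pblock P x | x <- s].
(* [bs] lists the part of each vertex in order, so [f i] is the least number in the part of [i]. *)
pose f i := index (b i) bs.
have nth_bs i : i < n -> nth set0 bs i = b i.
  by move=> lti; rewrite (nth_map x0) // size_s.
have b_bs i : i < n -> b i \in bs by move=> _; apply: (map_f (pblock P)).
have f_lt i : i < n -> f i < n.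
  by move=> /b_bs; rewrite -index_mem size_map size_s.
have bf i : i < n -> b (f i) = b i.
  by move=> lti; rewrite -nth_bs ?f_lt // nth_index // b_bs.
have ff i : i < n -> f (f i) = f i by move=> lti; rewrite /f -/(f i) bf.
have f_le i : i < n -> f i <= i.
  move=> lti; rewrite leqNgt; apply/negP => /(before_find set0).
  by rewrite nth_bs //= eqxx.
have nthc k i : i < k -> nth 0 (mkseq f k) i = f i by move=> ?; rewrite nth_mkseq.
have [|i lti|i j lti ltj|sizeP prcE] := @prcb_coloring P (mkseq f n) partP.
- by rewrite size_mkseq.
- by rewrite !nthc ?f_lt // ff.
- rewrite !nthc // -eq_pblock // -/(b i) -/(b j).
  apply/eqP/eqP => [eqf|]; first by rewrite -bf // eqf bf.
  by rewrite /f => ->.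
exists (mkseq f n); last by rewrite -prcE.
have non_roots : count (fun i => f i != i) (iota 0 n) <= 2.
  have := count_predC (fun i => f i == i) (iota 0 n); rewrite size_iota.
  move: sizeP; rewrite /class_reps size_mkseq size_filter.
  rewrite (@eq_in_count _ _ (fun i => f i == i)) => [|i].
    move=> cP cn; rewrite -(leq_add2l #|P|) (leq_trans _ leP) // -{1}cP.
    exact: (eq_leq cn).
  by rewrite mem_iota => /= lti; rewrite nthc.
(* Every prefix passes [coloring]: representatives stay inside it since [f i <= i], and it has no
   more non-representatives than the whole. *)
have gen_f k : k <= n -> mkseq f k \in gen coloring k.
  elim: k => // k IHk ltk; rewrite [mkseq f _]mkseqS.
  apply: gen_rcons; [exact/IHk/ltnW | exact: f_le |].
  rewrite -mkseqS /coloring size_mkseq; apply/andP; split.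
    apply: leq_trans non_roots.
    rewrite -[in X in _ <= X](subnKC ltk) iotaD count_cat.
    apply: leq_trans (leq_addr _ _); rewrite leq_eqVlt; apply/orP; left.
    by apply/eqP/eq_in_count => i; rewrite mem_iota => /= lti; rewrite nthc.
  apply/allP => i; rewrite mem_iota => /= lti; have ltin := leq_trans lti ltk.
  by rewrite !nthc ?ff // (leq_ltn_trans (f_le _ ltin)).
exact: gen_f.
Qed.

(** The fibres of the coloring form a prc-partition; this turns explicit colorings into lower
    bounds. *)
Lemma coloring_PRC c : size c = n -> coloring c ->
  all (fun i => nth 0 c i < n) (iota 0 n) -> prcb n H (color_classes c) ->
  size (class_reps c) <= PRC G.
Proof.
move=> sizec /andP[_ /allP rootc] /allP ltc prcc.
pose f x := nth 0 c (index x s).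
have eqf : {in setT & &, equivalence_rel (fun x y => f x == f y)}.
  by split=> // /eqP->.
have [i lti|i j lti ltj|-> prcE] :=
    @prcb_coloring _ c (preim_partitionP f [set: G]) sizec.
- have iin : i \in iota 0 n by rewrite mem_iota.
  by split; [exact: ltc | apply/eqP/rootc; rewrite sizec].
- rewrite pblock_equivalence_partition ?inE //=.
  by rewrite /f !index_uniq ?size_s.
by apply: (leq_bigmax_cond (F := fun P : {set {set G}} => #|P|)); rewrite prcE.
Qed.

End Encoding.

(** * Isomorphisms and the check of orders 3 to 8 *)

Lemma isomorphic_sym (G K : sgraph) : isomorphic G K -> isomorphic K G.
Proof.
case=> f [g fK gK] adjf; exists g; first by exists f.
by move=> x y; rewrite -adjf !gK.
Qed.

Lemma isomorphic_card (G K : sgraph) : isomorphic G K -> #|G| = #|K|.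
Proof. by case=> f bijf _; apply: bij_eq_card bijf. Qed.

Definition path_nat : rel nat := fun i j => (i.+1 == j) || (j.+1 == i).

Definition treeR_nat : rel nat :=
  fun i j => ((i, j) \in treeR_edges) || ((j, i) \in treeR_edges).

Definition extremalb n (H : rel nat) :=
  match n with
  | 4 | 5 | 7 => embedb n H path_nat n [::]
  | 6 => embedb n H path_nat n [::] || embedb n H treeR_nat n [::]
  | _ => false
  end.

(** [C] holds the candidate partitions with at least [n - 2] parts. Order 4 escapes the test on the
    number of parts, again because of the path. *)
Definition verify n :=
  let C := [seq color_classes c | c <- gen coloring n] in
  all (fun q => all (fun Q =>
      if prcb n (code_adj q) Q then
        extremalb n (code_adj q) &&
        ((n == 4) || (size Q == n - 2))
      else true) C) (gen tree_code n).

(** The range is 3 to 8: the order exceeds 2, and the leaf bound gives 8. *)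
Lemma verified : all verify (iota 3 6).
Proof. vm_cast_no_check (erefl true). Qed.

Section Embedding.
Variables (T X : sgraph) (x0 : T) (s : seq T) (H K : rel nat) (val : X -> nat).
Hypotheses (uniq_s : uniq s) (size_s : size s = #|T|).
Hypothesis adj_s : forall i j, i < #|T| -> j < #|T| ->
  adj (nth x0 s i) (nth x0 s j) = H i j.
Hypotheses (cardX : #|X| = #|T|) (val_inj : injective val).
Hypothesis val_lt : forall x, val x < #|X|.
Hypothesis adjX : forall x y, adj x y = K (val x) (val y).

(** The search places [K] in [H], so it yields an injection from [X] to [T], bijective since the
    orders agree. *)
Lemma embedb_isomorphic : embedb #|T| H K #|T| [::] -> isomorphic T X.
Proof.
case/embedbP=> [|||u [size_u uniq_u sub_u adj_u]] //; rewrite add0n in size_u.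
have val_u x : val x < size u by rewrite size_u -cardX.
have lt_u x : nth 0 u (val x) < #|T|.
  by have := sub_u _ (mem_nth 0 (val_u x)); rewrite mem_iota.
apply: isomorphic_sym; exists (fun x => nth x0 s (nth 0 u (val x))).
  apply: inj_card_bij; last by rewrite cardX.
  move=> x y /eqP; rewrite nth_uniq ?size_s // nth_uniq // => /eqP.
  exact: val_inj.
by move=> x y; rewrite adjX adj_s // adj_u.
Qed.

End Embedding.

(** The isomorphism is used to number [T] like [X], so that the coloring applies to [T] itself. *)
Lemma isomorphic_PRC (T : sgraph) m (X : sgraph) (K : rel nat) c
    (val : X -> 'I_m) (ord : 'I_m -> X) :
  cancel val ord -> cancel ord val ->
  (forall x y, adj x y = K (val x) (val y)) ->
  isomorphic T X -> size c = m -> coloring c ->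
  all (fun i => nth 0 c i < m) (iota 0 m) ->
  prcb m K (color_classes c) -> size (class_reps c) <= PRC T.
Proof.
move=> vK oK adjX /isomorphic_sym[g bijg adjg] sizec colc ltc prcc.
(* [ord0] and [inord] need a successor; for [m = 0] the coloring is empty. *)
case: m val ord vK oK adjX sizec ltc prcc
  => [|m] val ord vK oK adjX sizec ltc prcc.
  by case: c sizec {colc ltc prcc}.
have cardT : #|T| = m.+1.
  by rewrite -(bij_eq_card bijg) (bij_eq_card (Bijective vK oK)) card_ord.
pose x0 := g (ord ord0); pose s := [seq g (ord i) | i <- enum 'I_m.+1].
have nth_s i : i < m.+1 -> nth x0 s i = g (ord (inord i)).
  move=> lti; rewrite (nth_map ord0) ?size_enum_ord //.
  by congr (g (ord _)); apply: val_inj; rewrite /= nth_enum_ord // inordK.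
apply: (@coloring_PRC T x0 s K) => //; rewrite ?cardT //.
- rewrite map_inj_uniq ?enum_uniq //.
  exact: (inj_comp (bij_inj bijg) (can_inj oK)).
- by rewrite size_map size_enum_ord.
- by move=> i j lti ltj; rewrite !nth_s // adjg adjX !oK !inordK.
Qed.

(** * The bound on [PRC] and its equality cases *)

Theorem theorem4p8 (n : nat) (T : sgraph) (treeT : is_tree T)
    (orderT : #|T| = n) (n_gt2 : 2 < n)
    (T_neq_P4 : ~ isomorphic T (path_graph 4)) :
  PRC T <= n - 2 /\
  (PRC T = n - 2 <->
     [\/ isomorphic T (path_graph 5), isomorphic T (path_graph 6),
         isomorphic T (path_graph 7) | isomorphic T treeR]).
Proof.
(* This yields both the upper bound and the direct half of the equivalence. *)
have large (P : {set {set T}}) : prc_partition P -> n - 2 <= #|P| ->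
    #|P| = n - 2 /\
     [\/ isomorphic T (path_graph 5), isomorphic T (path_graph 6),
         isomorphic T (path_graph 7) | isomorphic T treeR].
  move=> prcP leP; have cardT : 2 < #|T| by rewrite orderT.
  have [x0 [s [q [[uniq_s size_s] qgen leq_q adj_s]]]] := tree_numbering treeT.
  have [|c cgen [prcc sizec]] := prc_coloring uniq_s size_s adj_s prcP.
    by rewrite orderT; lia.
  have n_le8 : n <= 8.
    rewrite leqNgt; apply/negP => n_gt8.
    have : #|T| <= 8; last by rewrite orderT; lia.
    have lt_n : #|T|.-1 < #|T| by rewrite prednK; lia.
    (* The last vertex of the numbering is nobody's parent, hence a leaf; its only neighbour is its
       parent, whose number is its code minus one. *)
    apply: (leaf_order_bound treeT cardT (l := nth x0 s #|T|.-1)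
      (s := nth x0 s (nth 0 q #|T|.-1).-1) prcP); try lia.
    move=> x; have xs : x \in s.
      by have [|| _ ->] := @uniq_min_size _ s (enum T) uniq_s;
        rewrite ?mem_enum -?cardE ?size_s // => y _; rewrite mem_enum.
    have lt_x : index x s < #|T| by rewrite -size_s index_mem.
    rewrite -{1}(nth_index x0 xs) adj_s // code_adjE => /orP[/eqP|/eqP->].
      by have := leq_q _ lt_x; lia.
    by rewrite /= nth_index.
  have /(allP verified)/allP : n \in iota 3 6 by rewrite mem_iota; lia.
  rewrite -orderT => /(_ q qgen)/allP/(_ (color_classes c)).
  rewrite map_f // => /(_ isT).
  rewrite prcc size_map sizec => /andP[ext].
  have iso m (X : sgraph) (K : rel nat) (v : X -> 'I_m) (w : 'I_m -> X) :
      cancel v w -> cancel w v ->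
      (forall x y, adj x y = K (v x) (v y)) -> n = m ->
      embedb #|T| (code_adj q) K #|T| [::] -> isomorphic T X.
    move=> vK wK adjX nm.
    have cardX : #|X| = m by rewrite (bij_eq_card (Bijective vK wK)) card_ord.
    apply: (embedb_isomorphic uniq_s size_s adj_s (val := fun x => v x)) => //.
    - by rewrite cardX orderT.
    - by move=> x y /val_inj/(can_inj vK).
    - by move=> x; rewrite cardX.
  have iso_path m : n = m -> embedb #|T| (code_adj q) path_nat #|T| [::] ->
      isomorphic T (path_graph m) by apply: (iso m (path_graph m) path_nat id id).
  have iso_R : n = 6 -> embedb #|T| (code_adj q) treeR_nat #|T| [::] ->
      isomorphic T treeR by apply: (iso 6 treeR treeR_nat id id).
  have n4 : n <> 4.
    move=> n4; apply: T_neq_P4; apply: (iso_path _ n4).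
    by move: ext; rewrite orderT n4.
  rewrite orderT; have /eqP/negPf-> := n4; move=> /eqP->; split=> //.
  rewrite orderT in ext iso_path iso_R.
  case: n ext iso_path iso_R n_gt2 n4 n_le8 {orderT prcc leq_q adj_s iso leP cardT}
    => [|[|[|[|[|[|[|[|[|n']]]]]]]]] // ext iso_path iso_R _ n4 _.
  - by apply: Or41; apply: iso_path.
  - case/orP: ext => ext; first by apply: Or42; apply: iso_path.
    by apply: Or44; apply: iso_R.
  - by apply: Or43; apply: iso_path.
have PRC_le : PRC T <= n - 2.
  apply/bigmax_leqP => P prcP; rewrite leqNgt; apply/negP => ltP.
  by have [E _] := large P prcP (ltnW ltP); rewrite E ltnn in ltP.
split=> //; split=> [PRC_eq|isoT].
  (* Since [n - 2] is positive, equality requires a partition attaining it: otherwise all have at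
     most [n - 3] parts. *)
  have [/existsP[P /andP[prcP leP]]|/existsPn noP] :=
      boolP [exists P : {set {set T}}, prc_partition P && (n - 2 <= #|P|)].
    by have [] := large P prcP leP.
  have : PRC T <= n - 3.
    by apply/bigmax_leqP => P prcP; have := noP P; rewrite prcP /=; lia.
  by lia.
apply/eqP; rewrite eqn_leq PRC_le /=.
have path m c : isomorphic T (path_graph m) -> size c = m -> coloring c ->
    all (fun i => nth 0 c i < m) (iota 0 m) ->
    prcb m path_nat (color_classes c) ->
    size (class_reps c) = m - 2 -> n - 2 <= PRC T.
  move=> isoT_ sizec colc ltc prcc.
  rewrite -orderT (isomorphic_card isoT_) card_ord => <-.
  by apply: (@isomorphic_PRC T m (path_graph m) path_nat c id id).
case: isoT => isoT.
(* Parts {0,1}, {2,3}, {4}: the first is a partner of both others. *)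
- exact: (path 5 [:: 0; 0; 2; 2; 4]).

(* Coalitions: {0,3} with {4}, {1,2} with {5}. *)
- exact: (path 6 [:: 0; 1; 1; 0; 4; 5]).
(* Coalitions: {0,3} with {6}, {1,5} with {2} and with {4}. *)
- exact: (path 7 [:: 0; 1; 2; 0; 4; 1; 6]).
rewrite -orderT (isomorphic_card isoT) card_ord.
(* Coalitions: {0,2} with {3}, {1,4} with {5}. *)
exact: (@isomorphic_PRC T 6 treeR treeR_nat [:: 0; 1; 0; 3; 1; 5] id id).
Qed.
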